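(* Let $\mathbf{X}_1,\mathbf{X}_2,\mathbf{X}_3$ be (possibly different) BNM schemes, and let $\mathbb{SS}$, $\mathbb{TT}$, $\mathbb{ST}$ be the sets of inferences valid according to the standard $\mathbf{ss}$ over $\mathbf{X}_1$, the standard $\mathbf{tt}$ over $\mathbf{X}_2$, and the standard $\mathbf{st}$ over $\mathbf{X}_3$, respectively. Let $\mathbb{CL}$ be the set of classically valid inferences. Then $$\mathbb{SS}\cup\mathbb{TT}\subsetneq\mathbb{ST}=\mathbb{CL}.$$
   Context: Formulas: the propositional language $\mathcal{L}$ is built from a denumerably infinite set $\mathit{Var}$ of propositional variables using only $\neg$, $\lor$, $\wedge$ (no propositional constants). An inference $\Gamma\Rightarrow\phi$ is an ordered pair $\langle\Gamma,\phi\rangle$ with $\Gamma\subseteq\mathcal{L}$ finite (possibly empty) and $\phi\in\mathcal{L}$. Schemes: a (three-valued) scheme $\mathbf{X}$ is a triple $(f_\neg,f_\wedge,f_\vee)$ of operations on $\{0,\frac12,1\}$ (unary, binary, binary). It is Boolean normal if each operation, restricted to arguments in $\{0,1\}$, agrees with the corresponding operation of the two-element Boolean algebra. Let $\leq_{\rm I}$ be the partial order on $\{0,\frac12,1\}$ whose strict part is $\frac12<_{\rm I}0$ and $\frac12<_{\rm I}1$. The scheme is monotonic if each of its operations is monotone from the componentwise order induced by $\leq_{\rm I}$ to $\leq_{\rm I}$. A BNM scheme is a Boolean normal monotonic scheme. An $\mathbf{X}$-valuation is a map $v:\mathcal{L}\to\{0,\frac12,1\}$ such that $v(\neg\phi)=f_\neg(v(\phi))$,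 $v(\phi\wedge\psi)=f_\wedge(v(\phi),v(\psi))$, $v(\phi\vee\psi)=f_\vee(v(\phi),v(\psi))$. Standards: let $\mathbf{s}=\{1\}$ and $\mathbf{t}=\{1,\frac12\}$. For $\mathbf{x},\mathbf{y}\in\{\mathbf{s},\mathbf{t}\}$, a valuation $v$ satisfies $\Gamma\Rightarrow\phi$ according to $\mathbf{xy}$ if: whenever $v(\gamma)\in\mathbf{x}$ for all $\gamma\in\Gamma$, then $v(\phi)\in\mathbf{y}$. An inference is valid according to $\mathbf{xy}$ over $\mathbf{X}$ if it is satisfied according to $\mathbf{xy}$ by every $\mathbf{X}$-valuation. $\mathbb{CL}$ is the set of inferences $\Gamma\Rightarrow\phi$ such that every ordinary two-valued Boolean valuation making all of $\Gamma$ true makes $\phi$ true. *)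

(* Defs.v *)
From HB Require Import structures.
From mathcomp Require Import all_boot.
From mathcomp Require Import finmap.
From mathcomp Require Import boolp classical_sets.

Set Implicit Arguments.
Unset Strict Implicit.
Unset Printing Implicit Defensive.

Local Open Scope classical_set_scope.

(* The denumerable set of propositional variables is taken to be nat. *)
Inductive formula : Type :=
  | Var of nat
  | Neg of formula
  | And of formula & formula
  | Or of formula & formula.

(* Encoding into trees, used only to make formula a countType, so that finite
   sets of formulas can be written {fset formula}. *)
Fixpoint tree_of_formula (a : formula) : GenTree.tree nat :=
  match a with
  | Var n => GenTree.Leaf n
  | Neg b => GenTree.Node 0 [:: tree_of_formula b]
  | And b c => GenTree.Node 1 [:: tree_of_formula b; tree_of_formula c]
  | Or b c => GenTree.Node 2 [:: tree_of_formula b; tree_of_formula c]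
  end.

Fixpoint formula_of_tree (t : GenTree.tree nat) : option formula :=
  match t with
  | GenTree.Leaf n => Some (Var n)
  | GenTree.Node 0 [:: t1] => omap Neg (formula_of_tree t1)
  | GenTree.Node 1 [:: t1; t2] =>
      obind (fun a => omap (And a) (formula_of_tree t2)) (formula_of_tree t1)
  | GenTree.Node 2 [:: t1; t2] =>
      obind (fun a => omap (Or a) (formula_of_tree t2)) (formula_of_tree t1)
  | _ => None
  end.

Lemma tree_of_formulaK : pcancel tree_of_formula formula_of_tree.
Proof. by elim=> //= [a ->|a -> b ->|a -> b ->]. Qed.

HB.instance Definition _ := Countable.copy formula (pcan_type tree_of_formulaK).

Definition inference : Type := ({fset formula} * formula)%type.

Inductive tval : Type := Zero | Half | One.

Definition tval_of_bool (b : bool) : tval := if b then One else Zero.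

Definition ltI (x y : tval) : Prop := x = Half /\ (y = Zero \/ y = One).

Definition leI (x y : tval) : Prop := x = y \/ ltI x y.

Record scheme : Type := Scheme {
  op_neg : tval -> tval;
  op_and : tval -> tval -> tval;
  op_or : tval -> tval -> tval
}.

Definition boolean_normal (X : scheme) : Prop :=
  [/\ forall a : bool,
        op_neg X (tval_of_bool a) = tval_of_bool (~~ a),
      forall a b : bool,
        op_and X (tval_of_bool a) (tval_of_bool b) = tval_of_bool (a && b)
    & forall a b : bool,
        op_or X (tval_of_bool a) (tval_of_bool b) = tval_of_bool (a || b)].

Definition monotonic (X : scheme) : Prop :=
  [/\ forall x x', leI x x' -> leI (op_neg X x) (op_neg X x'),
      forall x x' y y', leI x x' -> leI y y' ->
        leI (op_and X x y) (op_and X x' y')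
    & forall x x' y y', leI x x' -> leI y y' ->
        leI (op_or X x y) (op_or X x' y')].

Definition BNM (X : scheme) : Prop := boolean_normal X /\ monotonic X.

Definition valuation (X : scheme) (v : formula -> tval) : Prop :=
  [/\ forall a, v (Neg a) = op_neg X (v a),
      forall a b, v (And a b) = op_and X (v a) (v b)
    & forall a b, v (Or a b) = op_or X (v a) (v b)].

Definition strict : set tval := [set One].

Definition tolerant : set tval := [set One; Half].

Definition satisfies (x y : set tval) (v : formula -> tval) (i : inference) :
    Prop :=
  (forall g, g \in i.1 -> x (v g)) -> y (v i.2).

Definition valid (x y : set tval) (X : scheme) : set inference :=
  [set i | forall v, valuation X v -> satisfies x y v i].

Definition bool_valuation (v : formula -> bool) : Prop :=
  [/\ forall a, v (Neg a) = ~~ v a,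
      forall a b, v (And a b) = v a && v b
    & forall a b, v (Or a b) = v a || v b].

Definition CL : set inference :=
  [set i | forall v, bool_valuation v -> (forall g, g \in i.1 -> v g) -> v i.2].

(* Main.v *)
Require Import Defs.
From mathcomp Require Import all_boot.
From mathcomp Require Import finmap.
From mathcomp Require Import boolp classical_sets.

(** Two observations about Boolean normal monotonic (BNM) schemes carry the
    theorem.

    Classical valuations are three-valued valuations: by Boolean normality, a
    two-valued valuation read in {0, 1} is a valuation of every such scheme.
    Hence validity according to any of ss, tt, st implies classical validity
    ([valid_sub_CL]).

    Three-valued valuations can be sharpened to classical ones: replacing the
    value 1/2 of variables by a classical value makes, by monotonicity, every
    formula move upwards in the information order, so the formulas that were
    already 0 or 1 keep their value ([sharpening]).  A valuation with all
    premises 1 and conclusion 0 thus yields a classical counterexample, which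
    gives CL in ST ([CL_sub_ST]).  Together these give ST = CL and that SS and
    TT are included in it.

    The inclusion is strict because of the one classically valid inference
    r \/ (p /\ ~ p) => r /\ (q \/ ~ q).  The connectives of a BNM scheme are
    not determined by its axioms, but an operation must return 1/2 on
    arguments with two classical sharpenings that lead to different results
    ([leI_bool_clash]).  The two refutations involve only such values and
    Boolean ones, so they work in every BNM scheme:
    r = 1, p = 0, q = 1/2 gives the premise 1 and the conclusion 1/2, refuting
    ss; r = 0, p = 1/2, q = 0 gives the premise 1/2 and the conclusion 0,
    refuting tt.  Since one inference fails both, it is outside the union. *)

Local Open Scope classical_set_scope.

Lemma leI_Half (x : Defs.tval) : leI Half x.
Proof. by case: x; [right; split; auto | left | right; split; auto]. Qed.

Lemma leI_One (x : Defs.tval) : leI One x -> x = One.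
Proof. by case=> [<-|[]]. Qed.

Lemma leI_Zero (x : Defs.tval) : leI Zero x -> x = Zero.
Proof. by case=> [<-|[]]. Qed.

Lemma leI_bool_clash (x : Defs.tval) : leI x Zero -> leI x One -> x = Half.
Proof. by move=> + x1; case: x x1 => // [/leI_Zero|_ /leI_One]. Qed.

Lemma BNM_boolE {X : scheme} : BNM X ->
  ((op_neg X Zero = One) * (op_neg X One = Zero)) *
  ((op_and X Zero Zero = Zero) * (op_and X Zero One = Zero) *
   (op_and X One Zero = Zero) * (op_and X One One = One)) *
  ((op_or X Zero Zero = Zero) * (op_or X Zero One = One) *
   (op_or X One Zero = One) * (op_or X One One = One)).
Proof.
case=> -[N A O] _.
by rewrite (N true) (N false) (A true true) (A true false) (A false true)
  (A false false) (O true true) (O true false) (O false true) (O false false).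
Qed.

(** Each argument tuple below can be sharpened to Boolean arguments in two ways
    on which the Boolean operation differs.  Values such as that of the
    disjunction of 1 and 1/2 are deliberately absent: they vary with the scheme. *)
Lemma BNM_HalfE {X : scheme} : BNM X ->
  (op_neg X Half = Half) *
  ((op_and X Half Half = Half) * (op_and X One Half = Half)) *
  ((op_or X Half Half = Half) * (op_or X Zero Half = Half)).
Proof.
move=> hX; have B := BNM_boolE hX; case: hX => _ [mN mA mO].
have refl x : leI x x by left.
have h := leI_Half.
do ![split]; apply: leI_bool_clash.
- by have := mN _ _ (h One); rewrite !B.
- by have := mN _ _ (h Zero); rewrite !B.
- by have := mA _ _ _ _ (h Zero) (h Zero); rewrite !B.
- by have := mA _ _ _ _ (h One) (h One); rewrite !B.
- by have := mA _ _ _ _ (refl One) (h Zero); rewrite !B.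
- by have := mA _ _ _ _ (refl One) (h One); rewrite !B.
- by have := mO _ _ _ _ (h Zero) (h Zero); rewrite !B.
- by have := mO _ _ _ _ (h One) (h One); rewrite !B.
- by have := mO _ _ _ _ (refl Zero) (h Zero); rewrite !B.
- by have := mO _ _ _ _ (refl Zero) (h One); rewrite !B.
Qed.

Fixpoint eval (X : scheme) (e : nat -> Defs.tval) (a : formula) : Defs.tval :=
  match a with
  | Var n => e n
  | Neg b => op_neg X (eval X e b)
  | And b c => op_and X (eval X e b) (eval X e c)
  | Or b c => op_or X (eval X e b) (eval X e c)
  end.

Lemma eval_valuation (X : scheme) (e : nat -> Defs.tval) : valuation X (eval X e).
Proof. by []. Qed.

Fixpoint bool_eval (e : nat -> bool) (a : formula) : bool :=
  match a with
  | Var n => e n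
  | Neg b => ~~ bool_eval e b
  | And b c => bool_eval e b && bool_eval e c
  | Or b c => bool_eval e b || bool_eval e c
  end.

Lemma bool_eval_valuation (e : nat -> bool) : bool_valuation (bool_eval e).
Proof. by []. Qed.

Lemma valuation_of_bool (X : scheme) (v : formula -> bool) :
  boolean_normal X -> bool_valuation v -> valuation X (tval_of_bool \o v).
Proof.
move=> [N A O] [vN vA vO]; split=> [a|a b|a b] /=.
- by rewrite vN N.
- by rewrite vA A.
- by rewrite vO O.
Qed.

(** A classical counterexample is a counterexample for every pair of standards
    in which 1 is good enough for premises and 0 is not for conclusions; this
    covers ss, tt and st at once. *)
Lemma valid_sub_CL (x y : set Defs.tval) (X : scheme) :
  boolean_normal X -> x One -> ~ y Zero -> valid x y X `<=` CL.
Proof.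
move=> nX x1 y0 i iV v vB vG.
have := iV _ (valuation_of_bool _ _ nX vB).
rewrite /satisfies /=; case: (v i.2) => // H.
by case: y0; apply: H => g /vG /= ->.
Qed.

(** Since 1/2 is the least value, it does not matter how the variables with
    value 1/2 are sharpened; here they become false. *)
Lemma sharpening (X : scheme) (v : formula -> Defs.tval) :
  BNM X -> valuation X v ->
  exists2 u, bool_valuation u & forall a, leI (v a) (tval_of_bool (u a)).
Proof.
move=> [[N A O] [mN mA mO]] [vN vA vO].
exists (bool_eval (fun n => if v (Var n) is One then true else false));
  first exact: bool_eval_valuation.
elim=> [n|b IHb|b IHb c IHc|b IHb c IHc] /=.
- by case: (v (Var n)); [left | apply: leI_Half | left].
- by rewrite vN -N; apply: mN.
- by rewrite vA -A; apply: mA.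
- by rewrite vO -O; apply: mO.
Qed.

Lemma CL_sub_ST (X : scheme) : BNM X -> CL `<=` valid strict tolerant X.
Proof.
move=> hX i iC v /(sharpening _ _ hX) [u uB le_vu] vG.
have u2 : u i.2.
  apply: iC => // g /vG vg1; have := le_vu g.
  by rewrite vg1 => /leI_One; case: (u g).
have := le_vu i.2; rewrite u2 /tolerant /=.
by case: (v i.2) => [/leI_Zero|_|_]; [| right | left].
Qed.

(** The contradiction and the tautology use distinct variables so that either
    one can be given the value 1/2 while the other keeps a classical value: a
    single variable with value 1/2 would make the value of the premise under ss,
    a disjunction of 1 and 1/2, depend on the scheme. *)
Definition gap_inference : inference :=
  ([fset Or (Var 0) (And (Var 1) (Neg (Var 1)))]%fset,
   And (Var 0) (Or (Var 2) (Neg (Var 2)))).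

Lemma gap_inference_CL : CL gap_inference.
Proof.
move=> v [vN vA vO] /(_ _ (fset11 _)) /=.
by rewrite !(vN, vA, vO) andbN orbF orbN andbT.
Qed.

Lemma gap_inference_not_SS (X : scheme) :
  BNM X -> ~ valid strict strict X gap_inference.
Proof.
move=> hX.
pose e n := nth Half [:: One; Zero; Half] n.
move=> /(_ _ (eval_valuation X e)); rewrite /satisfies /strict /=.
rewrite !(BNM_HalfE hX) => H.
suff : Half = One by [].
by apply: H => g /fset1P -> /=; rewrite !(BNM_boolE hX).
Qed.

Lemma gap_inference_not_TT (X : scheme) :
  BNM X -> ~ valid tolerant tolerant X gap_inference.
Proof.
move=> hX.
pose e n := nth Half [:: Zero; Half; Zero] n.
move=> /(_ _ (eval_valuation X e)); rewrite /satisfies /tolerant /=.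
rewrite !(BNM_boolE hX) => H.
suff : Zero = One \/ Zero = Half by case.
by apply: H => g /fset1P -> /=; rewrite !(BNM_HalfE hX); right.
Qed.

Theorem theorem4p4 (X1 X2 X3 : scheme)
    (hX1 : BNM X1) (hX2 : BNM X2) (hX3 : BNM X3) :
  valid strict strict X1 `|` valid tolerant tolerant X2
    `<` valid strict tolerant X3
  /\ valid strict tolerant X3 = CL.
Proof.
have tol0 : ~ tolerant Zero by case.
have ST_CL : valid strict tolerant X3 = CL.
  apply/seteqP; split; last exact: CL_sub_ST.
  by apply: valid_sub_CL => //; case: hX3.
split=> //; rewrite ST_CL; split.
- move=> i [].
  + by apply: valid_sub_CL => //; case: hX1.
  + by apply: valid_sub_CL => //; [case: hX2 | left].
- move=> /(_ _ gap_inference_CL) [].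
  + exact: gap_inference_not_SS.
  + exact: gap_inference_not_TT.
Qed.
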